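(* For every integer $d\ge 1$ there is a constant $C_d>0$, depending only on $d$, such that the following holds. Let $K$ be a field with $\mathrm{char}(K)=0$ or $\mathrm{char}(K)>d$, let $n\ge 1$, and let $f\in K[x_1,\ldots,x_n]_d$ be a form of degree $d$ whose border strength is $\underline{s}(f)=r<\infty$. If $K$ is infinite, then $f$ lies in a $K$-subalgebra of $K[x_1,\ldots,x_n]$ generated by at most $C_d\, r^d$ elements of $D(f)$. If $K$ is finite, then $f$ lies in a $K$-subalgebra of $K[x_1,\ldots,x_n]$ generated by at most $C_d\, r^d\log(r+1)$ elements of $D(f)$.
   Context: $K[x_1,\ldots,x_n]_d$ is the space of homogeneous polynomials (forms) of degree $d$ over $K$ (including $0$). For $f\in K[x_1,\ldots,x_n]_d$, $D(f)$ is the $K$-subspace of $\bigoplus_{e=1}^{d-1}K[x_1,\ldots,x_n]_e$ spanned by all polynomials $\frac{\partial}{\partial x_{i_1}}\cdots\frac{\partial}{\partial x_{i_l}}f$ with $l\in\{1,\ldots,d-1\}$ and $i_1,\ldots,i_l\in\{1,\ldots,n\}$. Let $\mathcal{P}_d$ be the affine space over $\mathbb{Z}$ with coordinates labelled by the monomials of degree $d$ in $x_1,\ldots,x_n$; its $K$-points are the degree-$d$ forms over $K$. The border strength $\underline{s}(f)$ of $f\in K[x_1,\ldots,x_n]_d$ is the minimal $r\geq 0$ for which there exist $d_1,\ldots,d_r\in\{1,\ldots,d-1\}$ such that $f$ is a $K$-point of the Zariski closure of the image of the morphism (over $\mathbb{Z}$) $$\mu_{d_1,\ldots,d_r}:\prod_{i=1}^r(\mathcal{P}_{d_i}\times\mathcal{P}_{d-d_i})\to\mathcal{P}_d,\quad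 ((a_1,b_1),\ldots,(a_r,b_r))\mapsto\sum_{i=1}^r a_ib_i.$$ The border strength of a nonzero linear form is $\infty$. The logarithm is to base $2$. *)

(* Defs.v *)
From HB Require Import structures.
From mathcomp Require Import all_boot all_order all_algebra.
From mathcomp Require Import mpoly.
From mathcomp Require Import boolp classical_sets cardinality reals exp.

Set Implicit Arguments.
Unset Strict Implicit.
Unset Printing Implicit Defensive.

Import Order.TTheory GRing.Theory Num.Theory.

Local Open Scope classical_set_scope.
Local Open Scope ring_scope.

(* Forms of degree d over L in n variables are the elements of {mpoly L[n]}
   satisfying the predicate d.-homog, which holds of 0 for every d. *)

Definition log2 (R : realType) (x : R) : R := ln x / ln 2.

Definition subspace_span (K : fieldType) (V : lmodType K) (G : set V) : set V :=
  smallest [set U : set V | GRing.submod_closed (mem U)] G.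

Definition subalgebra_gen (K : fieldType) (A : algType K) (G : set A) : set A :=
  smallest [set U : set A | GRing.subalg_closed (mem U)] G.

Definition iter_deriv (K : fieldType) (n : nat) (s : seq 'I_n)
    (f : {mpoly K[n]}) : {mpoly K[n]} :=
  foldr (fun i g => g^`M(i)) f s.

(* D(f), for f of degree d. *)
Definition deriv_space (K : fieldType) (n d : nat) (f : {mpoly K[n]}) :
    set {mpoly K[n]} :=
  subspace_span
    [set g | exists2 s : seq 'I_n, (0 < size s < d)%N & g = iter_deriv s f].

(* The affine space P_d over Z has coordinate ring {mpoly int[#|monomials n d|]},
   the i-th variable being the coordinate of the monomial enum_val i. *)
Definition monomials (n d : nat) : {set 'X_{1..n < d.+1}} :=
  [set m : 'X_{1..n < d.+1} | mdeg m == d]%SET.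

Definition coord_eval (n d : nat) (L : fieldType) (g : {mpoly L[n]})
    (P : {mpoly int[#|monomials n d|]}) : L :=
  mmap intr (fun i : 'I_#|monomials n d| => g@_(enum_val i)) P.

(* The L-points of the closed subset V(S) of P_d. The points of a scheme are
   represented by its field-valued points, so a closed subset of P_d is
   determined by its L-points for all fields L. *)
Definition zero_locus (n d : nat) (S : set {mpoly int[#|monomials n d|]})
    (L : fieldType) : set {mpoly L[n]} :=
  [set g | g \is d.-homog /\ forall P, S P -> coord_eval g P = 0].
Arguments zero_locus {n d} S L _.

(* The image of the L-points under mu_{d_1,...,d_r}. *)
Definition mu_image (n d r : nat) (dd : 'I_r -> nat) (L : fieldType) :
    set {mpoly L[n]} :=
  [set g | exists a b : 'I_r -> {mpoly L[n]},
    (forall i, a i \is (dd i).-homog /\ b i \is (d - dd i)%N.-homog)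
    /\ g = \sum_(i < r) a i * b i].
Arguments mu_image n d {r} dd L _.

(* The K-points of the Zariski closure of the image of mu_{d_1,...,d_r}, i.e.
   the forms lying in every closed subset of P_d that contains the image. As
   everything is over Z, the image has points over all fields L, which need be
   neither extensions of K nor of the same characteristic. *)
Definition mu_closure (n d r : nat) (dd : 'I_r -> nat) (K : fieldType) :
    set {mpoly K[n]} :=
  [set f | f \is d.-homog /\
    forall S : set {mpoly int[#|monomials n d|]},
      (forall L : fieldType, mu_image n d dd L `<=` zero_locus S L) ->
      zero_locus S K f].
Arguments mu_closure {n} d {r} dd K _.

Definition has_border_decomp (K : fieldType) (n d : nat) (f : {mpoly K[n]})
    (r : nat) : Prop :=
  exists dd : 'I_r -> nat,
    (forall i, 0 < dd i < d)%N /\ mu_closure d dd K f.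

(* The border strength of f is the natural number r; it is infinite when this
   holds for no r. *)
Definition has_border_strength (K : fieldType) (n d : nat) (f : {mpoly K[n]})
    (r : nat) : Prop :=
  has_border_decomp d f r /\
  forall r', has_border_decomp d f r' -> (r <= r')%N.

(* f lies in a K-subalgebra generated by at most B elements of D(f). *)
Definition in_deriv_subalgebra (R : realType) (K : fieldType) (n d : nat)
    (f : {mpoly K[n]}) (B : R) : Prop :=
  exists gs : seq {mpoly K[n]},
    [/\ (size gs)%:R <= B,
        [set` gs] `<=` deriv_space d f &
        subalgebra_gen [set` gs] f].

(* Main.v *)
(** Let [T] be the symmetric [d]-linear form of [f], normalised so that
    [T(x, ..., x) = d! f(x)].  For vectors [u j i] with [j < d], [i < N], consider
    the [N ^ d] numbers [c_I = T(u 0 (I 0), ..., u (d-1) (I (d-1)))].  If [f] is a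
    sum of [r] products of forms of lower degree, they are quadratic polynomials
    in [O_d(r N ^ (d-1))] parameters, so for [N = O_d(r)] a count of monomials
    yields a multilinear integer relation [h(c) = 0], nonzero modulo every prime,
    of degree polynomial in [r].  This relation passes to the Zariski closure.

    Replace [h] by a relation of minimal degree satisfied by [f] and write
    [h = h_0 + c_t h_1]; by minimality [h_1(c)] is not zero for generic [u], hence
    not zero for suitable [u] with small entries in [K[X]]: constants if [K] is
    infinite, and polynomials of degree [O_d(log (r + 1))] with coefficients 0
    and 1 otherwise.  Now move every [u j (t j)] to [u j (t j) + eps x].  In
    [h(c) = 0] the form [f] occurs only as [eps ^ d d! f(x)] inside [c_t], so that
    the coefficient of [eps ^ d] expresses [d! h_1(c) f] through the coefficients
    of [eps ^ k X ^ m] in all the [c_I] with [k < d], each of which is a linear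
    combination of partial derivatives of [f] of order [d - k]. *)

Require Import Defs.
From HB Require Import structures.
From mathcomp Require Import all_boot all_order all_algebra.
From mathcomp Require Import mpoly.
From mathcomp Require Import boolp classical_sets cardinality reals exp.

Set Implicit Arguments.
Unset Strict Implicit.
Unset Printing Implicit Defensive.

Import Order.TTheory GRing.Theory Num.Theory.

Local Open Scope classical_set_scope.
Local Open Scope ring_scope.

(** * Polarisation and the Leibniz rule *)

(* The derivative of [g] along the vectors [vs], of coordinates in [B], taken at the
   origin. *)
Fixpoint polar (A B : comNzRingType) (n : nat) (phi : A -> B)
    (vs : seq ('I_n -> B)) (g : {mpoly A[n]}) : B :=
  if vs is v :: vs' then \sum_(i < n) v i * polar phi vs' g^`M(i)
  else phi g@_0%MM.

Section Polar.

Variables (A B : comNzRingType) (n : nat) (phi : {rmorphism A -> B}).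
Implicit Types (g a b : {mpoly A[n]}) (vs : seq ('I_n -> B)).

Lemma polarD vs : {morph polar phi vs : a b / a + b}.
Proof.
elim: vs => [|v vs IHvs] a b /=; first by rewrite mcoeffD rmorphD.
rewrite -big_split; apply: eq_bigr => i _.
by rewrite mderivD IHvs mulrDr.
Qed.

Lemma polar0 vs : polar phi vs 0 = 0.
Proof. by apply: (addrI (polar phi vs 0)); rewrite -polarD !addr0. Qed.

Lemma polar_sum vs (I : Type) (r : seq I) (F : I -> {mpoly A[n]}) :
  polar phi vs (\sum_(i <- r) F i) = \sum_(i <- r) polar phi vs (F i).
Proof. exact: (big_morph _ (polarD vs) (polar0 vs)). Qed.

(** Leibniz rule: [t] marks the vectors that differentiate [a], the others differentiate [b]. *)
Lemma polarM vs a b :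
  polar phi vs (a * b) =
  \sum_(t : (size vs).-tuple bool)
     polar phi (mask t vs) a * polar phi (mask (map negb t) vs) b.
Proof.
elim: vs a b => [|v vs IHvs] a b /=.
  rewrite (eq_bigl (pred1 [tuple])) => [|t]; last exact/esym/eqP/tuple0.
  by rewrite big_pred1_eq /= rmorphM rmorphM.
rewrite (reindex (fun p : bool * (size vs).-tuple bool => cons_tuple p.1 p.2)).
  rewrite -(pair_bigA _ (fun x t =>
    polar phi (mask (cons_tuple x t) (v :: vs)) a *
    polar phi (mask (map negb (cons_tuple x t)) (v :: vs)) b)) /=.
  rewrite big_bool /= -big_split /=.
  under [RHS]eq_bigr do rewrite mulr_suml mulr_sumr -big_split /=.
  rewrite exchange_big; apply: eq_bigr => i _ /=.
  rewrite mderivM polarD !IHvs mulrDr !mulr_sumr -big_split.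
  by apply: eq_bigr => t _; rewrite mulrA [in RHS]mulrCA.
exists (fun t => (thead t, behead_tuple t)) => [[x t] _|t _] /=.
  by congr pair; apply: val_inj.
by rewrite [RHS]tuple_eta; apply: val_inj.
Qed.

Lemma polarM_tuple m vs a b : size vs = m ->
  polar phi vs (a * b) =
  \sum_(t : m.-tuple bool)
     polar phi (mask t vs) a * polar phi (mask (map negb t) vs) b.
Proof. by move=> <-; exact: polarM. Qed.

Lemma polar_homog_nil g k : g \is k.-homog -> (0 < k)%N -> polar phi [::] g = 0.
Proof.
move=> g_homog k_gt0.
rewrite /= (@dhomog_nemf_coeff _ _ mdeg k) ?raddf0 //=.
by rewrite mdeg0 neq_ltn k_gt0.
Qed.

End Polar.

Lemma map_mpoly_mderiv (A B : comNzRingType) (n : nat) (s : {rmorphism A -> B})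
    (i : 'I_n) (g : {mpoly A[n]}) :
  map_mpoly s g^`M(i) = (map_mpoly s g)^`M(i).
Proof.
apply/mpolyP => m.
by rewrite mcoeff_map_mpoly !mcoeff_mderiv mcoeff_map_mpoly raddfMn.
Qed.

(** Naturality, used whenever coefficients or vectors are specialised: generic form to actual form,
    generic vectors to given ones, [eps] to 0. *)
Lemma polar_map (A A' B B' : comNzRingType) (n : nat)
    (s : {rmorphism A -> A'}) (psi : {rmorphism B -> B'})
    (phi : A -> B) (phi' : A' -> B')
    (vs : seq ('I_n -> B)) (g : {mpoly A[n]}) :
    (forall x, psi (phi x) = phi' (s x)) ->
  psi (polar phi vs g) =
  polar phi' [seq psi \o v | v <- vs] (map_mpoly s g).
Proof.
move=> comm; elim: vs g => [|v vs IHvs] g /=.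
  by rewrite comm mcoeff_map_mpoly.
rewrite rmorph_sum; apply: eq_bigr => i _.
by rewrite rmorphM IHvs map_mpoly_mderiv.
Qed.

Lemma map_mpoly_id (A : comNzRingType) (n : nat) (g : {mpoly A[n]}) :
  map_mpoly idfun g = g.
Proof. by apply/mpolyP => m; rewrite mcoeff_map_mpoly. Qed.

(** * Integer relations by counting monomials *)

(* Each monomial [m] of degree at most [k] has [\prod_i 2 ^ (k - m i)] at least
   [2 ^ (n k - k)], and these products sum to at most [2 ^ (n (k + 1))]. *)
Lemma card_bmultinom_le (n k : nat) : (#|{: 'X_{1..n < k.+1}}| <= 2 ^ (n + k))%N.
Proof.
case: n => [|n'].
  rewrite (leq_trans _ (expn_gt0 2 k)) // -card_unit.
  by apply: (@leq_card _ _ (fun=> tt)) => m m' _; apply/val_inj/mnmP => - [].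
set n := n'.+1; have n_gt0 : (0 < n)%N by [].
pose F (h : {ffun 'I_n -> 'I_k.+1}) := (\prod_i 2 ^ (k - h i))%N.
pose enc (m : 'X_{1..n < k.+1}) : {ffun 'I_n -> 'I_k.+1} :=
  [ffun i => inord (m i)].
have le_k (m : 'X_{1..n < k.+1}) i : (m i <= k)%N.
  apply: leq_trans (_ : mdeg m <= k)%N; last by rewrite -ltnS bmdeg.
  by rewrite mdegE (bigD1 i) // leq_addr.
have encE m i : enc m i = m i :> nat by rewrite ffunE inordK // ltnS le_k.
have enc_inj : injective enc.
  move=> m m' eq_m; apply/val_inj/mnmP => i.
  by rewrite -!encE eq_m.
have F_ge m : (2 ^ (n * k - k) <= F (enc m))%N.
  rewrite /F -expn_sum leq_exp2l //.
  under eq_bigr do rewrite encE.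
  rewrite leq_subLR.
  have -> : (n * k = mdeg m + \sum_(i < n) (k - m i))%N.
    rewrite mdegE -big_split /= (eq_bigr (fun=> k)) => [|i _]; last first.
      by rewrite subnKC.
    by rewrite sum_nat_const card_ord.
  by rewrite leq_add2r -ltnS bmdeg.
have F_sum : (\sum_h F h <= 2 ^ (n * k.+1))%N.
  rewrite /F -(bigA_distr_bigA (fun (_ : 'I_n) (j : 'I_k.+1) => 2 ^ (k - j)))%N.
  rewrite prod_nat_const card_ord mulnC expnM leq_exp2r //.
  rewrite (reindex_inj rev_ord_inj) /=.
  rewrite (eq_bigr (fun i : 'I_k.+1 => 2 ^ i))%N => [|i _]; last first.
    by rewrite subSS subKn // -ltnS.
  by rewrite (leq_trans _ (leq_pred _)) // predn_exp mul1n.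
rewrite -(@leq_pmul2l (2 ^ (n * k - k))) ?expn_gt0 // -expnD.
have -> : (n * k - k + (n + k) = n * k.+1)%N.
  by rewrite mulnS addnCA subnK // leq_pmull.
apply: leq_trans F_sum.
apply: leq_trans (_ : \sum_m F (enc m) <= _)%N.
  by rewrite mulnC -sum_nat_const leq_sum.
rewrite -(big_imset _ (in2W enc_inj)) /=.
by rewrite big_mkcond leq_sum // => h _; case: ifP.
Qed.

(* The column [w] witnesses that [v] stays nonzero modulo every prime. *)
Lemma int_matrix_unimodular_ker (m n : nat) (M : 'M[int]_(m, n)) : (n < m)%N ->
  exists2 v : 'rV[int]_m, v *m M = 0 & exists w : 'cV[int]_m, v *m w = 1%:M.
Proof.
case: m M => // m M; rewrite ltnS => le_nm.
have [L Lu [S _ [s _ defM]]] := int_Smith_normal_form M.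
(* The middle factor of the Smith form has more rows than columns, so its last row is zero. *)
exists (row ord_max (invmx L)).
  rewrite {1}defM !mulmxA -row_mul mulVmx // -row_mul mul1mx -row_mul.
  apply/rowP => j; rewrite !mxE big1 // => i _.
  by rewrite mxE gtn_eqF ?mulr0n ?mul0r // (leq_trans (ltn_ord i)).
exists (col ord_max L).
apply/matrixP => i j; rewrite !ord1 !mxE.
have := congr1 (fun A : 'M_m.+1 => A ord_max ord_max) (mulVmx Lu).
rewrite !mxE !eqxx => <-.
by apply: eq_bigr => k _; rewrite !mxE.
Qed.

(* The [9 ^ D] products of one polynomial from each of [D] disjoint groups of nine
   have degree at most [2 D], and there are fewer than [9 ^ D] monomials of such
   degrees. *)
Lemma multilinear_dependence (D : nat) (T : finType) (q : T -> {mpoly int[D]}) :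
    (0 < D)%N -> (9 * D <= #|T|)%N -> (forall t, msize (q t) <= 3)%N ->
  exists v w : {set T} -> int,
    [/\ \sum_A v A * w A = 1,
        forall A, v A != 0 -> #|A| = D
      & \sum_A (v A)%:MP * \prod_(t in A) q t = 0].
Proof.
move=> D_gt0 leDT q_deg.
have cardDT : (#|{: 'I_D * 'I_9}| <= #|T|)%N by rewrite card_prod !card_ord mulnC.
(* [emb] embeds [D] groups of nine into [T]; [sigma h] takes one element from each group. *)
pose emb (x : 'I_D * 'I_9) : T := enum_val (widen_ord cardDT (enum_rank x)).
have emb_inj : injective emb.
  move=> x y /enum_val_inj /(congr1 val) /= eq_xy.
  exact/enum_rank_inj/val_inj.
pose X := {ffun 'I_D -> 'I_9}.
pose sigma (h : X) := [set emb (i, h i) | i : 'I_D]%SET.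
have emb_fst_inj (h : X) : injective (fun i => emb (i, h i)).
  by move=> i j /emb_inj [].
have sigma_card h : #|sigma h| = D by rewrite card_imset ?card_ord.
have sigma_inj : injective sigma.
  move=> h h' eq_h; apply/ffunP => i.
  have : emb (i, h i) \in sigma h' by rewrite -eq_h; apply/imsetP; exists i.
  by case/imsetP => j _ /emb_inj [-> ->].
pose Q (A : {set T}) := \prod_(t in A) q t.
have Q_deg h : (msize (Q (sigma h)) <= (2 * D).+1)%N.
  rewrite /Q -[X in (_ * X)%N](sigma_card h) -sum1_card.
  elim/big_rec2: _ => [|t s p _ le_ps]; first by rewrite msize1.
  have [->|nzq] := eqVneq (q t) 0; first by rewrite mul0r msize0.
  have [->|nzp] := eqVneq p 0; first by rewrite mulr0 msize0.
  move: (leq_add (q_deg t) le_ps); rewrite msizeM // mulnDr.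
  by case: (_ + _)%N.
pose mon (j : 'I_#|{: 'X_{1..D < (2 * D).+1}}|) := enum_val j : 'X_{1..D}.
pose M : 'M[int]_(#|X|, _) :=
  \matrix_(x, j) (Q (sigma (enum_val x)))@_(mon j).
have [|v vM [w vw]] := @int_matrix_unimodular_ker _ _ M.
  (* The monomials number at most [2 ^ (D + 2 * D) = 8 ^ D], less than [9 ^ D]. *)
  apply: leq_ltn_trans (card_bmultinom_le _ _) _.
  rewrite card_ffun !card_ord -mulSn expnM.
  by rewrite ltn_exp2r.
(* As [sigma] is injective, [vA] and [wA] are [v] and [w] indexed by sets and extended by zero. *)
pose vA A := \sum_(x | sigma (enum_val x) == A) v 0 x.
pose wA A := if [pick x | sigma (enum_val x) == A] is Some x then w x 0 else 0.
have vA_sum (V : lmodType int) (F : {set T} -> V) :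
  \sum_A vA A *: F A = \sum_x v 0 x *: F (sigma (enum_val x)).
  rewrite (partition_big (fun x => sigma (enum_val x)) predT) //=.
  apply: eq_bigr => A _; rewrite scaler_suml.
  by apply: eq_bigr => x /eqP->.
have wA_sigma x : wA (sigma (enum_val x)) = w x 0.
  rewrite /wA; case: pickP => [y /eqP/sigma_inj/enum_val_inj -> //|/(_ x)].
  by rewrite eqxx.
exists vA, wA; split.
- rewrite -[LHS]/(\sum_A vA A *: (wA A : int^o)) vA_sum.
  have := congr1 (fun A : 'M_1 => A 0 0) vw; rewrite !mxE => vw1.
  apply: etrans _ vw1; apply: eq_bigr => x _; rewrite wA_sigma.
  exact: erefl.
- move=> A; have [x /eqP <-|noA] := pickP (fun x : 'I_#|X| => sigma (enum_val x) == A).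
    by rewrite sigma_card.
  by rewrite /vA big_pred0 ?eqxx.
under eq_bigr do rewrite mul_mpolyC.
rewrite vA_sum; apply/mpolyP => m; rewrite mcoeff0 raddf_sum /=.
under eq_bigr do rewrite mcoeffZ.
have [lt_m|le_m] := ltnP (mdeg m) (2 * D).+1; last first.
  rewrite big1 // => x _; rewrite memN_msupp_eq0 ?mulr0 //.
  by apply: msize_mdeg_ge; rewrite (leq_trans (Q_deg _)) // ltnW.
have := congr1 (fun A : 'rV_ _ => A 0 (enum_rank (BMultinom lt_m))) vM.
rewrite !mxE => vMm; apply: etrans _ vMm; apply: eq_bigr => x _.
by rewrite mxE /mon enum_rankK.
Qed.

(** * A relation valid for all forms of low strength *)

Definition slots (B : Type) (d N n : nat) (u : 'I_d -> 'I_N -> 'I_n -> B)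
    (I : {ffun 'I_d -> 'I_N}) : seq ('I_n -> B) :=
  [seq u j (I j) | j <- enum 'I_d].

(** Relations are kept as coefficient functions on sets, since only squarefree monomials occur. *)
Definition multilin (A B : comNzRingType) (T : finType) (psi : A -> B)
    (h : {set T} -> A) (c : T -> B) : B :=
  \sum_(E : {set T}) psi (h E) * \prod_(t in E) c t.

(** The polar of a factor on a proper subset of the slots ignores some entry [I j]. Indexing it by
    [forget j I] leaves [N ^ d] parameters against [N ^ d.+1] values. *)
Definition forget (d N : nat) (j : 'I_d.+1) (I : {ffun 'I_d.+1 -> 'I_N}) :
    {ffun 'I_d -> 'I_N} :=
  [ffun k => I (lift j k)].

Lemma forget_factor (B : nzRingType) (d N : nat) (j : 'I_d.+1)
    (X : {ffun 'I_d.+1 -> 'I_N} -> B) :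
    (forall I I' : {ffun 'I_d.+1 -> 'I_N},
       (forall i, i != j -> I i = I' i) -> X I = X I') ->
  exists alpha, forall I, X I = alpha (forget j I).
Proof.
move=> X_eq.
exists (fun p => if [pick K | forget j K == p] is Some K then X K else 0) => I.
case: pickP => [I' /eqP/ffunP eq_I|/(_ I)]; last by rewrite eqxx.
apply: X_eq => i; case: (unliftP j i) => [k ->|->]; last by rewrite eqxx.
by move=> _; have := eq_I k; rewrite !ffunE.
Qed.

Lemma slots_mask (B : Type) (d N n : nat) (u : 'I_d -> 'I_N -> 'I_n -> B)
    (I : {ffun 'I_d -> 'I_N}) (t : d.-tuple bool) :
  mask t (slots u I) = [seq u j (I j) | j <- enum 'I_d & tnth t j].
Proof. by rewrite filter_mask map_tnth_enum map_mask. Qed.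

Lemma slots_maskC (B : Type) (d N n : nat) (u : 'I_d -> 'I_N -> 'I_n -> B)
    (I : {ffun 'I_d -> 'I_N}) (t : d.-tuple bool) :
  mask (map negb t) (slots u I) =
  [seq u j (I j) | j <- enum 'I_d & ~~ tnth t j].
Proof.
rewrite -[in LHS](map_tnth_enum t) -map_comp -map_mask.
by rewrite (filter_mask (fun j => ~~ tnth t j)).
Qed.

(** The default is met only when [t] selects all slots or none; the Leibniz term then vanishes,
    because both factors are forms of positive degree. *)
Definition pick_ord (d : nat) (P : pred 'I_d.+1) : 'I_d.+1 :=
  odflt ord0 [pick i | P i].

Definition some_out (d : nat) (t : d.+1.-tuple bool) : 'I_d.+1 :=
  pick_ord (fun i => ~~ tnth t i).

Definition some_in (d : nat) (t : d.+1.-tuple bool) : 'I_d.+1 :=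
  pick_ord (tnth t).

Lemma polar_factor (A B : comNzRingType) (phi : {rmorphism A -> B})
    (d N n : nat) (u : 'I_d.+1 -> 'I_N -> 'I_n -> B) (a : {mpoly A[n]})
    (P : pred 'I_d.+1) (j : 'I_d.+1) :
    ~~ P j ->
  exists alpha, forall I : {ffun 'I_d.+1 -> 'I_N},
    polar phi [seq u i (I i) | i <- enum 'I_d.+1 & P i] a =
    alpha (forget j I).
Proof.
move=> notPj; apply: forget_factor => I I' eq_I; congr (polar phi _ a).
apply/eq_in_map => i; rewrite mem_filter => /andP[Pi _]; rewrite eq_I //.
by apply: contraNneq notPj => <-.
Qed.

(** In the Leibniz term of [t], the factor from [a] ignores the slot [some_out t] and the factor
    from [b] the slot [some_in t]. *)
Lemma polar_low_strength (A B : comNzRingType) (phi : {rmorphism A -> B})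
    (d N n r : nat) (dd : 'I_r -> nat) (u : 'I_d.+1 -> 'I_N -> 'I_n -> B)
    (a b : 'I_r -> {mpoly A[n]}) :
    (forall k, 0 < dd k < d.+1)%N ->
    (forall k, a k \is (dd k).-homog /\ b k \is (d.+1 - dd k).-homog) ->
  exists alpha beta : 'I_r * d.+1.-tuple bool -> {ffun 'I_d -> 'I_N} -> B,
  forall I, polar phi (slots u I) (\sum_k a k * b k) =
    \sum_x alpha x (forget (some_out x.2) I) * beta x (forget (some_in x.2) I).
Proof.
move=> dd_bounds ab_homog.
suff /choice[ab Hab] : forall x : 'I_r * d.+1.-tuple bool, exists ab,
    forall I : {ffun 'I_d.+1 -> 'I_N},
    polar phi [seq u j (I j) | j <- enum 'I_d.+1 & tnth x.2 j] (a x.1) *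
    polar phi [seq u j (I j) | j <- enum 'I_d.+1 & ~~ tnth x.2 j] (b x.1) =
    ab.1 (forget (some_out x.2) I) * ab.2 (forget (some_in x.2) I).
  exists (fun x => (ab x).1), (fun x => (ab x).2) => I.
  rewrite polar_sum.
  rewrite [RHS](eq_bigr (fun x => (ab (x.1, x.2)).1 (forget (some_out x.2) I)
      * (ab (x.1, x.2)).2 (forget (some_in x.2) I))) => [|[]//].
  rewrite -(pair_bigA _ (fun k t => (ab (k, t)).1 (forget (some_out t) I)
      * (ab (k, t)).2 (forget (some_in t) I))) /=.
  apply: eq_bigr => k _.
  rewrite (@polarM_tuple _ _ _ _ d.+1); last by rewrite size_map size_enum_ord.
  by apply: eq_bigr => t _; rewrite slots_mask slots_maskC (Hab (k, t)).
move=> [k t] /=; have [a_homog b_homog] := ab_homog k.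
have /andP[dd_gt0 dd_lt] := dd_bounds k.
rewrite /some_out /some_in /pick_ord.
case: pickP => [j /= out_j|all_in]; last first.
  exists (fun=> 0, fun=> 0) => I /=.
  rewrite (@eq_filter _ (fun j => ~~ tnth t j) pred0) ?filter_pred0 //.
  by rewrite (polar_homog_nil _ b_homog) ?subn_gt0 ?mulr0.
case: pickP => [i /= in_i|none_in]; last first.
  exists (fun=> 0, fun=> 0) => I /=.
  rewrite (@eq_filter _ (fun j => tnth t j) pred0) ?filter_pred0 //.
  by rewrite (polar_homog_nil _ a_homog) ?mul0r.
have [alpha Halpha] := polar_factor phi u (a k) out_j.
have [|beta Hbeta] := @polar_factor _ _ phi _ _ _ u (b k) (fun l => ~~ tnth t l) i.
  by rewrite negbK.
by exists (alpha, beta) => I; rewrite Halpha Hbeta.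
Qed.

(** Taking the values of [alpha] and [beta] as independent variables, one gets [N ^ d.+1] quadratic
    polynomials over the integers. A relation between these specialises to every commutative
    ring. *)
Lemma low_strength_dependence (d r N : nat) :
    (0 < r)%N -> (0 < N)%N ->
    (9 * (2 * (r * 2 ^ d.+1 * N ^ d)) <= N ^ d.+1)%N ->
  exists v w : {set {ffun 'I_d.+1 -> 'I_N}} -> int,
    [/\ \sum_E v E * w E = 1,
        forall E, v E != 0 -> #|E| = (2 * (r * 2 ^ d.+1 * N ^ d))%N
      & forall (B : comNzRingType)
          (alpha beta : 'I_r * d.+1.-tuple bool -> {ffun 'I_d -> 'I_N} -> B),
        multilin intr v (fun I => \sum_x alpha x (forget (some_out x.2) I)
                                       * beta x (forget (some_in x.2) I)) = 0].
Proof.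
move=> r_gt0 N_gt0 leN.
pose P := ('I_r * d.+1.-tuple bool * {ffun 'I_d -> 'I_N})%type.
set D := (2 * _)%N in leN *.
have cardP : #|{: bool * P}| = D.
  by rewrite !card_prod card_bool card_tuple card_ffun !card_ord card_bool.
pose ix (p : bool * P) : 'I_D := cast_ord cardP (enum_rank p).
pose q (I : {ffun 'I_d.+1 -> 'I_N}) : {mpoly int[D]} :=
  \sum_(x : 'I_r * d.+1.-tuple bool)
     'X_(ix (true, (x, forget (some_out x.2) I)))
   * 'X_(ix (false, (x, forget (some_in x.2) I))).
have [|||v [w [vw v_card vq]]] := @multilinear_dependence D _ q.
- by rewrite !muln_gt0 r_gt0 !expn_gt0 N_gt0.
- by rewrite card_ffun !card_ord.
- move=> I; rewrite /q; apply: leq_trans (mmeasure_sum _ _ _ _) _.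
  apply/bigmax_leqP => x _; rewrite -mpolyXD msizeX.
  by rewrite mdegD !mdeg1.
exists v, w; split=> // B alpha beta.
pose val_at (i : 'I_D) : B :=
  let: (s, (x, p)) := enum_val (cast_ord (esym cardP) i) in
  if s then alpha x p else beta x p.
have val_ix s x p : val_at (ix (s, (x, p))) = if s then alpha x p else beta x p.
  by rewrite /val_at /ix cast_ordK enum_rankK.
have /(congr1 (mmap intr val_at)) := vq.
rewrite raddf0 raddf_sum /= => vq0; apply: etrans _ vq0.
apply: eq_bigr => E _; rewrite rmorphM /= mmapC rmorph_prod; congr (_ * _).
apply: eq_bigr => I _; rewrite /q raddf_sum /=; apply: eq_bigr => x _.
by rewrite rmorphM /= !mmapX !mmap1U !val_ix.
Qed.

Lemma rmorph_multilin (A B B' : comNzRingType) (T : finType) (psi : A -> B)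
    (psi' : A -> B') (s : {rmorphism B -> B'}) (h : {set T} -> A) (c : T -> B) :
    (forall x, s (psi x) = psi' x) ->
  s (multilin psi h c) = multilin psi' h (fun t => s (c t)).
Proof.
move=> s_psi; rewrite rmorph_sum; apply: eq_bigr => E _.
by rewrite rmorphM rmorph_prod s_psi.
Qed.

Lemma eq_multilin (A B : comNzRingType) (T : finType) (psi : A -> B)
    (h : {set T} -> A) (c c' : T -> B) :
  c =1 c' -> multilin psi h c = multilin psi h c'.
Proof.
move=> eq_c; apply: eq_bigr => E _; congr (_ * _).
by apply: eq_bigr => t _; rewrite eq_c.
Qed.

(** * Passage to the Zariski closure *)

Lemma slots_map (B B' : Type) (d N n : nat) (s : B -> B')
    (u : 'I_d -> 'I_N -> 'I_n -> B) (I : {ffun 'I_d -> 'I_N}) :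
  [seq s \o v | v <- slots u I] = slots (fun j i k => s (u j i k)) I.
Proof. by rewrite /slots -map_comp. Qed.

Definition generic_form (n d : nat) : {mpoly {mpoly int[#|monomials n d|]}[n]} :=
  \sum_(i < #|monomials n d|) 'X_i *: 'X_[enum_val i].

Lemma map_generic_form (n d : nat) (L : fieldType) (g : {mpoly L[n]}) :
    g \is d.-homog ->
  map_mpoly (@coord_eval n d L g) (generic_form n d) = g.
Proof.
move=> g_homog; apply/mpolyP => m.
rewrite mcoeff_map_mpoly /generic_form raddf_sum /coord_eval raddf_sum /=.
under eq_bigr do rewrite mcoeffZ mcoeffX rmorphM /= mmapX mmap1U rmorph_nat.
have [m_deg|m_deg] := eqVneq (mdeg m) d; last first.
  rewrite (dhomog_nemf_coeff g_homog) // big1 // => i _.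
  case: eqP => [eq_m|_]; last by rewrite mulr0n mulr0.
  by have := enum_valP i; rewrite inE eq_m (negPf m_deg).
have lt_m : (mdeg m < d.+1)%N by rewrite m_deg.
have m_in : BMultinom lt_m \in monomials n d by rewrite inE /= m_deg.
rewrite (bigD1 (enum_rank_in m_in (BMultinom lt_m))) //= enum_rankK_in //= eqxx.
rewrite mulr1 big1 ?addr0 // => i ne_i.
case: eqP => [eq_m|_]; last by rewrite mulr0n mulr0.
case/eqP: ne_i; apply: enum_val_inj; rewrite enum_rankK_in //.
exact: val_inj.
Qed.

(* The coefficients of the relation for the generic form with respect to generic
   vectors are integral equations vanishing on the image of mu. *)
Lemma closure_relation (d N n r : nat) (dd : 'I_r -> nat) (K : fieldType)
    (f : {mpoly K[n]}) (v : {set {ffun 'I_d.+1 -> 'I_N}} -> int) :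
    (forall k, 0 < dd k < d.+1)%N -> mu_closure d.+1 dd K f ->
    (forall (B : comNzRingType)
       (alpha beta : 'I_r * d.+1.-tuple bool -> {ffun 'I_d -> 'I_N} -> B),
     multilin intr v (fun I => \sum_x alpha x (forget (some_out x.2) I)
                                    * beta x (forget (some_in x.2) I)) = 0) ->
  forall (B : comNzRingType) (phi : {rmorphism K -> B}) u,
  multilin intr v (fun I => polar phi (slots u I) f) = 0.
Proof.
move=> dd_bounds [f_homog f_cl] v_rel.
pose m := #|{: 'I_d.+1 * 'I_N * 'I_n}|.
pose B0 : comNzRingType := {mpoly int[#|monomials n d.+1|]}.
pose U (R : comNzRingType) (j : 'I_d.+1) (i : 'I_N) (k : 'I_n) : {mpoly R[m]} :=
  'X_(enum_rank (j, i, k)).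
pose H : {mpoly B0[m]} := multilin intr v
  (fun I => polar (@mpolyC m B0) (slots (U B0) I) (generic_form n d.+1)).
have H_eval (L : fieldType) (g : {mpoly L[n]}) : g \is d.+1.-homog ->
    map_mpoly (@coord_eval n d.+1 L g) H =
    multilin intr v (fun I => polar (@mpolyC m L) (slots (U L) I) g).
  move=> g_homog.
  pose s : {rmorphism B0 -> L} :=
    mmap intr (fun i : 'I_#|monomials n d.+1| => g@_(enum_val i)).
  rewrite -[in RHS](map_generic_form g_homog) -/s.
  rewrite (rmorph_multilin (psi' := intr) (s := map_mpoly s)); last first.
    by move=> x; rewrite rmorph_int.
  apply: eq_multilin => I.
  rewrite (@polar_map _ _ _ _ _ s (map_mpoly s) _ (@mpolyC m L)).
    rewrite slots_map; congr (polar _ (slots _ _) _).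
    by apply/funext => j; apply/funext => i; apply/funext => k; rewrite /U /= map_mpolyX.
  by move=> x /=; rewrite map_mpolyC.
have [|_ f0] := f_cl [set P | exists w, P = H@_w].
  move=> L g [a [b [ab_homog defg]]].
  have g_homog : g \is d.+1.-homog.
    rewrite defg rpred_sum // => k _; have [a_homog b_homog] := ab_homog k.
    rewrite -(subnKC (_ : dd k <= d.+1)%N) ?dhomogM //.
    by have /andP[_ /ltnW] := dd_bounds k.
  split=> // _ [w ->].
  rewrite -[LHS]mcoeff_map_mpoly H_eval // defg.
  have [alpha [beta Hab]] :=
    polar_low_strength (@mpolyC m L) (U L) dd_bounds ab_homog.
  by rewrite (eq_multilin _ _ Hab) v_rel mcoeff0.
move=> B phi u.
have H0 : multilin intr v (fun I => polar (@mpolyC m K) (slots (U K) I) f) = 0.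
  apply/mpolyP => w; rewrite -H_eval // mcoeff0 mcoeff_map_mpoly.
  by apply: f0; exists w.
(* The relation for generic vectors over [K] is specialised to [u]. *)
pose val_at (x : 'I_m) : B := let: (j, i, k) := enum_val x in u j i k.
have /(congr1 (mmap phi val_at)) := H0.
rewrite raddf0 (rmorph_multilin (psi' := intr)); last first.
  by move=> x; rewrite rmorph_int.
move=> H0'; apply: etrans _ H0'; apply: eq_multilin => I.
rewrite (@polar_map _ _ _ _ _ idfun (mmap phi val_at) _ phi).
  rewrite map_mpoly_id slots_map; congr (polar _ (slots _ _) _).
  apply/funext => j; apply/funext => i; apply/funext => k.
  by rewrite /= mmapX mmap1U /val_at enum_rankK.
by move=> x /=; rewrite mmapC.
Qed.

(** * Relations of minimal degree *)

Section Relations.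

Variables (K : fieldType) (T : finType).
Implicit Types (h : {set T} -> K) (t : T).

(* [h = free_part t h + c_t * lin_part t h]. *)
Definition free_part t h (E : {set T}) : K := if t \in E then 0 else h E.
Definition lin_part t h (E : {set T}) : K :=
  if t \in E then 0 else h (t |: E)%SET.

Lemma multilin_split (B : comNzRingType) (phi : {rmorphism K -> B}) h t c :
  multilin phi h c =
  multilin phi (free_part t h) c + c t * multilin phi (lin_part t h) c.
Proof.
have part0 (g : {set T} -> K) :
    \sum_(E : {set T}) phi (if t \in E then 0 else g E) * \prod_(x in E) c x =
    \sum_(E : {set T} | t \notin E) phi (g E) * \prod_(x in E) c x.
  rewrite [LHS](bigID (fun E : {set T} => t \in E)) /= big1 ?add0r.
    by apply: eq_bigr => E /negPf->.
  by move=> E ->; rewrite rmorph0 mul0r.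
rewrite /multilin /free_part /lin_part (part0 (fun E => h (t |: E)%SET)) part0.
rewrite (bigID (fun E : {set T} => t \in E)) /= addrC; congr (_ + _).
rewrite big_distrr /= (reindex_onto (fun E => t |: E)%SET (fun E => E :\ t)%SET).
  rewrite /=; apply: eq_big => [E|E].
    rewrite setU11 /=; apply/eqP/idP => [<-|tE]; first by rewrite setD11.
    by rewrite finset.setU1K.
  rewrite setU11 /= => /eqP Et.
  have tE : t \notin E by rewrite -Et setD11.
  by rewrite big_setU1 //= mulrCA.
by move=> E tE; rewrite finset.setD1K.
Qed.

(** Here [V] is the property of being a relation. Some [t] occurs in a nonconstant monomial of [h],
    as constant relations vanish. The part of [h] linear in [t] is nonzero and of smaller degree: if
    it is not a relation, [h] itself serves, and otherwise the induction applies to it. *)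
Lemma minimal_relation (V : ({set T} -> K) -> Prop) (D : nat) h :
    (forall g, V g -> (forall E : {set T}, E != finset.set0 -> g E = 0) ->
       g finset.set0 = 0) ->
    V h -> (exists E, h E != 0) -> (forall E, h E != 0 -> (#|E| <= D)%N) ->
  exists g t, [/\ V g, ~ V (lin_part t g) &
                  forall E, lin_part t g E != 0 -> (#|E| <= D)%N].
Proof.
move=> V_const; elim: D h => [|D IHD] h Vh [E hE] h_supp.
  case/eqP: (hE); have /eqP/cards0_eq -> : #|E| == 0%N.
    by rewrite -leqn0 h_supp.
  apply: V_const => // E'; apply: contra_neq_eq => /h_supp.
  by rewrite leqn0 => /eqP/cards0_eq.
have [E' E'n0 hE'] : exists2 E' : {set T}, E' != finset.set0 & h E' != 0.
  apply: contrapT => noE; case/eqP: (hE).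
  have h0 E' : E' != finset.set0 -> h E' = 0.
    by move=> E'n0; apply/eqP/negPn/negP => hE'; apply: noE; exists E'.
  by have [->|/h0//] := eqVneq E finset.set0; apply: V_const.
have [t tE'] := set0Pn _ E'n0.
have lin_supp E'' : lin_part t h E'' != 0 -> (#|E''| <= D)%N.
  rewrite /lin_part; case: ifPn => [_|tE'']; first by rewrite eqxx.
  by move/h_supp; rewrite cardsU1 tE''.
have [Vlin|nVlin] := pselect (V (lin_part t h)); last first.
  by exists h, t; split=> // E'' /lin_supp/leqW.
have [||g [x [Vg nVg g_supp]]] := IHD _ Vlin.
- exists (E' :\ t)%SET.
  by rewrite /lin_part setD11 /= finset.setD1K.
- by [].
by exists g, x; split=> // E'' /g_supp/leqW.
Qed.

End Relations.

(** * Degree bounds and specialisation of the vectors *)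

(** [P a] is the step [a] of a ring filtration; the instances bound degrees in [X], in [eps], and in
    [X] for each power of [eps]. *)
Lemma polar_filtered (A B : comNzRingType) (n : nat) (phi : A -> B)
    (P : nat -> B -> Prop) (X : Type) (w : X -> nat) (v : X -> 'I_n -> B)
    (s : seq X) (g : {mpoly A[n]}) :
    (forall a, P a 0) -> (forall a x y, P a x -> P a y -> P a (x + y)) ->
    (forall a b x y, P a x -> P b y -> P (a + b)%N (x * y)) ->
    (forall x, P 0%N (phi x)) -> (forall x i, P (w x) (v x i)) ->
  P (\sum_(x <- s) w x)%N (polar phi [seq v x | x <- s] g).
Proof.
move=> P0 PD PM Pphi Pv; elim: s g => [|x s IHs] g /=.
  by rewrite big_nil.
rewrite big_cons; apply: (big_ind (P _)) => // [y z|i _]; first exact: PD.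
exact: PM.
Qed.

Lemma size_polar_slots (A R : comNzRingType) (d N n b : nat)
    (phi : A -> {poly R}) (u : 'I_d -> 'I_N -> 'I_n -> {poly R})
    (I : {ffun 'I_d -> 'I_N}) (g : {mpoly A[n]}) :
    (forall x, size (phi x) <= 1)%N -> (forall j i k, size (u j i k) <= b.+1)%N ->
  (size (polar phi (slots u I) g) <= (d * b).+1)%N.
Proof.
move=> phi_size u_size.
have := @polar_filtered A _ n phi (fun a x => size x <= a.+1)%N 'I_d
  (fun=> b) (fun j => u j (I j)) (enum 'I_d) g.
rewrite big_const_seq count_predT size_enum_ord iter_addn_0 mulnC; apply=> //.
- by move=> a; rewrite size_poly0.
- move=> a x y x_size y_size; apply: leq_trans (size_polyD _ _) _.
  by rewrite geq_max x_size.
move=> a c x y x_size y_size; apply: leq_trans (size_polyMleq _ _) _.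
by move: (leq_add x_size y_size); rewrite addnS addSn; case: (_ + _)%N.
Qed.

Lemma size_multilin (K : fieldType) (T : finType) (R : comNzRingType)
    (phi : {rmorphism K -> R}) (h : {set T} -> K) (c : T -> {poly R}) (m D : nat) :
    (forall E, h E != 0 -> (#|E| <= D)%N) -> (forall t, (size (c t) <= m.+1)%N) ->
  (size (multilin (fun x => (phi x)%:P) h c) <= (m * D).+1)%N.
Proof.
move=> h_supp c_size; apply: leq_trans (size_sum _ _ _) _.
apply/bigmax_leqP => E _.
have [->|/h_supp leED] := eqVneq (h E) 0.
  by rewrite rmorph0 polyC0 mul0r size_poly0.
rewrite mul_polyC; apply: leq_trans (size_scale_leq _ _) _.
apply: leq_trans (_ : (m * #|E|).+1 <= _)%N; last by rewrite ltnS leq_mul2l leED orbT.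
rewrite -sum1_card; elim/big_rec2: _ => [|t k p _ p_size].
  by rewrite size_poly1.
apply: leq_trans (size_polyMleq _ _) _.
move: (leq_add (c_size t) p_size); rewrite mulnDr muln1 addSn addnS.
by case: (_ + _)%N.
Qed.

(** The coordinates are replaced one at a time. In each of them [G] is a nonzero polynomial with
    fewer than [s] roots, so some element of [S] is not a root. *)
Lemma specialise_one (B : idomainType) (W : eqType) (G : (W -> B) -> B)
    (s : nat) (S : seq B) :
    uniq S -> (s <= size S)%N ->
    (forall u x, exists2 Q : {poly B}, (size Q <= s)%N &
       forall b, Q.[b] = G (fun y => if y == x then b else u y)) ->
  forall (l : seq W) u, G u != 0 ->
  exists2 u', G u' != 0 & {in l, forall x, u' x \in S}.
Proof.
move=> S_uniq le_sS G_poly; elim=> [|x l IHl] u Gu; first by exists u.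
have [u' Gu' u'_in] := IHl u Gu.
have [Q Q_size Q_eval] := G_poly u' x.
have Q0 : Q != 0.
  apply: contraNneq Gu' => Q0; move: (Q_eval (u' x)); rewrite Q0 horner0.
  move=> ->; apply/eqP; congr G; apply/funext => y.
  by case: eqP => [->|].
have [b bS Qb] : exists2 b, b \in S & ~~ root Q b.
  apply/hasP; rewrite has_predC; apply/negP => all_root.
  have := max_poly_roots Q0 all_root S_uniq.
  by rewrite ltnNge (leq_trans Q_size).
exists (fun y => if y == x then b else u' y); first by rewrite -Q_eval.
move=> y; rewrite inE; case: eqP => //= _; exact: u'_in.
Qed.

(** Both the given vectors over [B] and the set [S] map into [{poly B}], a domain, where the entries
    are exchanged one by one. *)
Lemma specialise (K : fieldType) (d N n D : nat) (f : {mpoly K[n]})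
    (h : {set {ffun 'I_d -> 'I_N}} -> K) (S : seq {poly K})
    (B : idomainType) (phi : {rmorphism K -> B}) u :
    (forall E, h E != 0 -> (#|E| <= D)%N) ->
    uniq S -> (d * D < size S)%N ->
    multilin phi h (fun I => polar phi (slots u I) f) != 0 ->
  exists2 u' : 'I_d -> 'I_N -> 'I_n -> {poly K},
    forall j i k, u' j i k \in S &
    multilin polyC h (fun I => polar polyC (slots u' I) f) != 0.
Proof.
move=> h_supp S_uniq ltS hu.
pose W := ('I_d * 'I_N * 'I_n)%type.
pose s : {rmorphism {poly K} -> {poly B}} := map_poly phi.
pose phi' : {rmorphism K -> {poly B}} := polyC \o phi.
pose G (u : W -> {poly B}) : {poly B} :=
  multilin phi' h (fun I => polar phi' (slots (fun j i k => u (j, i, k)) I) f).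
have s_inj : injective s by exact: map_inj_poly (fmorph_inj phi) (rmorph0 phi).
have [||u0 x||u' Gu' u'_in] := @specialise_one {poly B} W G (d * D).+1
    (map s S) _ _ _ (enum {: W}) (fun x => (u x.1.1 x.1.2 x.2)%:P).
- by rewrite map_inj_uniq.
- by rewrite size_map.
(* The entry to be exchanged becomes a variable: each polar has degree at most [d] in it, and a
   monomial has at most [D] factors. *)
- pose ux j i k := if (j, i, k) == x then 'X else (u0 (j, i, k))%:P.
  exists (multilin (fun y => (phi' y)%:P) h
            (fun I => polar (polyC \o phi') (slots ux I) f)).
    rewrite -[d in (d * D)%N]muln1; apply: size_multilin => // I.
    apply: size_polar_slots => [y|j i k]; first by rewrite size_polyC leq_b1.
    rewrite /ux; case: eqP => _; first by rewrite size_polyX.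
    by rewrite size_polyC; case: (_ == _).
  move=> b; pose e : {rmorphism {poly {poly B}} -> {poly B}} := horner_eval b.
  rewrite -[LHS]/(e _) (rmorph_multilin (psi' := phi')); last first.
    by move=> y; apply: hornerC.
  apply: eq_multilin => I.
  rewrite (@polar_map _ _ _ _ _ idfun e _ phi'); last first.
    by move=> y; apply: hornerC.
  rewrite map_mpoly_id slots_map; congr (polar _ (slots _ _) _).
  apply/funext => j; apply/funext => i; apply/funext => k.
  by rewrite /e /= horner_evalE /ux; case: eqP => _; rewrite ?hornerX ?hornerC.
- have -> : G (fun x => (u x.1.1 x.1.2 x.2)%:P) =
      (multilin phi h (fun I => polar phi (slots u I) f))%:P.
    rewrite (rmorph_multilin (psi' := phi')) //.
    apply: eq_multilin => I.
    rewrite (@polar_map _ _ _ _ _ idfun polyC _ phi') // map_mpoly_id slots_map.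
    by [].
  by rewrite polyC_eq0.
have /choice[w Hw] : forall x : W, exists y, y \in S /\ u' x = s y.
  move=> x; have /mapP[y yS ->] : u' x \in map s S by apply: u'_in; rewrite mem_enum.
  by exists y.
exists (fun j i k => w (j, i, k)) => [j i k|]; first by have [] := Hw (j, i, k).
apply: contraNneq Gu' => /(congr1 s); rewrite rmorph0 => w0.
apply/eqP; apply: etrans _ w0; apply/esym.
rewrite (rmorph_multilin (psi' := phi')); last by move=> x /=; rewrite map_polyC.
apply: eq_multilin => I.
rewrite (@polar_map _ _ _ _ _ idfun s _ phi'); last first.
  by move=> x /=; rewrite map_polyC.
rewrite map_mpoly_id slots_map; congr (polar _ (slots _ _) _).
apply/funext => j; apply/funext => i; apply/funext => k.
by have [_ ->] := Hw (j, i, k).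
Qed.

(** * Euler's identity and algebraically closed sets of polynomials *)

Lemma mpoly_euler (R : comNzRingType) (n k : nat) (g : {mpoly R[n]}) :
  g \is k.-homog -> \sum_(i < n) 'X_i * g^`M(i) = g *+ k.
Proof.
move=> g_homog; rewrite [in LHS](mpolyE g).
under eq_bigr do rewrite raddf_sum mulr_sumr.
have -> : g *+ k = \sum_(m <- msupp g) (g@_m *: 'X_[m]) *+ k.
  by rewrite sumrMnl -mpolyE.
rewrite exchange_big /= big_seq [RHS]big_seq.
apply: eq_bigr => m /(dhomog_mf g_homog) /= m_deg.
under eq_bigr do rewrite mderivZ -scalerAr mderivX -scalerAr.
rewrite -scaler_sumr scalerMnr; congr (_ *: _).
rewrite -m_deg mdegE -sumrMnr; apply: eq_bigr => i _.
have [->|mi] := eqVneq (m i) 0%N; first by rewrite scale0r mulr0n.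
by rewrite -mpolyXD addmC submK ?lep1mP // scaler_nat.
Qed.

Lemma mderiv_homog (R : comNzRingType) (n k : nat) (i : 'I_n) (g : {mpoly R[n]}) :
  g \is k.+1.-homog -> g^`M(i) \is k.-homog.
Proof.
move=> g_homog; apply/dhomogP => m; rewrite mcoeff_msupp mcoeff_mderiv => gm.
have : (m + U_(i))%MM \in msupp g.
  by rewrite mcoeff_msupp; apply: contraNneq gm => ->; rewrite mul0rn.
by move=> /(dhomog_mf g_homog) /=; rewrite mdegD mdeg1 addn1 => -[].
Qed.

Lemma homog0_const (R : comNzRingType) (n : nat) (g : {mpoly R[n]}) :
  g \is 0.-homog -> g = (g@_0%MM)%:MP.
Proof.
move=> g_homog; apply/mpolyP => m; rewrite mcoeffC.
have [->|m0] := eqVneq m 0%MM; first by rewrite mulr1.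
by rewrite mulr0 (dhomog_nemf_coeff g_homog) //= mdeg_eq0.
Qed.

Lemma submod_closed_set (K : fieldType) (V : lmodType K) (U : set V) :
  GRing.submod_closed (mem U) ->
  [/\ U 0, forall x y, U x -> U y -> U (x + y)
    & forall c x, U x -> U (c *: x)].
Proof.
move=> [U0 Ulin].
have UE x : U x <-> x \in mem U by rewrite in_setE.
have Ulin' c x y : U x -> U y -> U (c *: x + y).
  by move=> /UE Ux /UE Uy; apply/UE; apply: Ulin.
have {}U0 : U 0 by apply/UE.
split=> // [x y Ux Uy|c x Ux]; first by rewrite -[x]scale1r; apply: Ulin'.
by rewrite -[_ *: _]addr0; apply: Ulin'.
Qed.

Lemma subalg_closed_set (K : fieldType) (A : algType K) (U : set A) :
  GRing.subalg_closed (mem U) ->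
  [/\ U 1, forall x y, U x -> U y -> U (x + y),
      forall x y, U x -> U y -> U (x * y)
    & forall c x, U x -> U (c *: x)].
Proof.
move=> [U1 Ulin UM].
have UE x : U x <-> x \in mem U by rewrite in_setE.
have Ulin' c x y : U x -> U y -> U (c *: x + y).
  by move=> /UE Ux /UE Uy; apply/UE; apply: Ulin.
have {}U1 : U 1 by apply/UE.
have U0 : U 0 by rewrite -(subrr 1) addrC -scaleN1r; apply: Ulin'.
split=> // [x y Ux Uy|x y /UE Ux /UE Uy|c x Ux].
- by rewrite -[x]scale1r; apply: Ulin'.
- by apply/UE; apply: UM.
by rewrite -[_ *: _]addr0; apply: Ulin'.
Qed.

(** * Differential operators with constant coefficients *)

Section ConstantCoefficientOperators.

Variables (K : fieldType) (n : nat).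
Implicit Types (f g : {mpoly K[n]}).

(** Operators homogeneous of order [j], zero included. Induction on their construction shows that
    they commute with derivatives and map [f] into [deriv_space] when [0 < j < d]. *)
Inductive diffop : nat -> ({mpoly K[n]} -> {mpoly K[n]}) -> Prop :=
| diffop_id : diffop 0 id
| diffop_zero j : diffop j (fun=> 0)
| diffop_add j th th' :
    diffop j th -> diffop j th' -> diffop j (fun g => th g + th' g)
| diffop_scale j c th : diffop j th -> diffop j (fun g => c *: th g)
| diffop_deriv j i th : diffop j th -> diffop j.+1 (fun g => th g^`M(i)).

Lemma diffop_comm j th : diffop j th ->
  forall i g, th g^`M(i) = (th g)^`M(i).
Proof.
elim=> //= {j th}.
- by move=> j i g; rewrite mderiv0.
- by move=> j th th' _ IH _ IH' i g; rewrite IH IH' mderivD.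
- by move=> j c th _ IH i g; rewrite IH mderivZ.
by move=> j i th _ IH i' g; rewrite mderiv_comm IH.
Qed.

Lemma diffop_homog j th : diffop j th ->
  forall k g, (j <= k)%N -> g \is k.-homog -> th g \is (k - j).-homog.
Proof.
elim=> //= {j th}.
- by move=> k g _; rewrite subn0.
- by move=> *; rewrite dhomog0.
- by move=> j th th' _ IH _ IH' k g jk gk; rewrite dhomogD ?IH ?IH'.
- by move=> j c th _ IH k g jk gk; apply: dhomogZ; apply: IH.
move=> j i th _ IH [//|k] g jk gk; rewrite subSS.
by apply: IH => //; apply: mderiv_homog.
Qed.

Lemma diffop_sum j (X : Type) (r : seq X) (th : X -> {mpoly K[n]} -> {mpoly K[n]}) :
  (forall x, diffop j (th x)) -> diffop j (fun g => \sum_(x <- r) th x g).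
Proof.
move=> th_op; elim: r => [|x r IHr].
  have -> : (fun g => \sum_(x <- [::]) th x g) = (fun=> 0); last exact: diffop_zero.
  by apply/funext => g; rewrite big_nil.
have -> : (fun g => \sum_(y <- x :: r) th y g) =
    (fun g => th x g + \sum_(y <- r) th y g); last exact: diffop_add.
by apply/funext => g; rewrite big_cons.
Qed.

Lemma diffop_deriv_space d f j th :
  diffop j th -> (0 < j < d)%N -> deriv_space d f (th f).
Proof.
move=> th_op j_bounds U [Ucl subU].
have [U0 UD UZ] := submod_closed_set Ucl.
(* The derivatives already taken are collected in [s], as the step for [diffop_deriv] requires. *)
suff : forall s, (0 < j + size s < d)%N -> U (th (iter_deriv s f)).
  by move=> /(_ [::]); rewrite addn0; apply.
elim: th_op {j_bounds} => {j th} //=.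
- by move=> s s_bounds; apply: subU; exists s.
- by move=> j th th' _ IH _ IH' s s_bounds; apply: UD; [apply: IH|apply: IH'].
- by move=> j c th _ IH s s_bounds; apply: UZ; apply: IH.
move=> j i th _ IH s; rewrite addSnnS => s_bounds.
by apply: (IH (i :: s)); rewrite s_bounds addnS.
Qed.

End ConstantCoefficientOperators.

(** * Moving the vectors by [eps x] *)

Section Perturbation.

Variables (K : fieldType) (n : nat).

Definition cst : {rmorphism K -> {poly {poly {mpoly K[n]}}}} :=
  polyC \o (polyC \o @mpolyC n K).

(* The variable of the inner polynomial ring is [X], that of the outer one is [eps]. *)
Definition perturb (p : 'I_n -> {poly K}) (moved : bool) (i : 'I_n) :
    {poly {poly {mpoly K[n]}}} :=
  (map_poly (@mpolyC n K) (p i))%:P +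
  (if moved then ('X_i)%:P%:P * 'X else 0).

Variables (X : Type) (u : X -> 'I_n -> {poly K}) (moved : pred X).

Let polarp (s : seq X) (g : {mpoly K[n]}) : {poly {poly {mpoly K[n]}}} :=
  polar cst [seq perturb (u y) (moved y) | y <- s] g.

Lemma size_polar_perturb s g : (size (polarp s g) <= (count moved s).+1)%N.
Proof.
have := @polar_filtered K _ n cst (fun a x => size x <= a.+1)%N X
  moved (fun y => perturb (u y) (moved y)) s g.
have -> : (\sum_(y <- s) moved y)%N = count moved s.
  by rewrite -sum1_count [RHS]big_mkcond; apply: eq_bigr => y _; case: (moved y).
apply.
- by move=> a; rewrite size_poly0.
- move=> a x y x_size y_size; apply: leq_trans (size_polyD _ _) _.
  by rewrite geq_max x_size.
- move=> a c x y x_size y_size; apply: leq_trans (size_polyMleq _ _) _.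
  by move: (leq_add x_size y_size); rewrite addnS addSn; case: (_ + _)%N.
- by move=> x; rewrite size_polyC leq_b1.
move=> y i; apply: leq_trans (size_polyD _ _) _; rewrite geq_max size_polyC.
rewrite (leq_trans (leq_b1 _)) //=; case: ifP => _; last by rewrite size_poly0.
by rewrite mul_polyC (leq_trans (size_scale_leq _ _)) // size_polyX.
Qed.

Lemma size_coef_polar_perturb s g e k : (forall y i, size (u y i) <= e.+1)%N ->
  (size ((polarp s g)`_k)%R <= (size s * e).+1)%N.
Proof.
move=> u_size; have := @polar_filtered K _ n cst
  (fun a x => forall k, size (x`_k)%R <= a.+1)%N X (fun=> e)
  (fun y => perturb (u y) (moved y)) s g.
rewrite big_const_seq count_predT iter_addn_0 mulnC; apply.
- by move=> a l; rewrite coef0 size_poly0.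
- move=> a x y x_size y_size l; rewrite coefD.
  apply: leq_trans (size_polyD _ _) _.
  by rewrite geq_max x_size y_size.
- move=> a c x y x_size y_size l; rewrite coefM.
  apply: leq_trans (size_sum _ _ _) _; apply/bigmax_leqP => i _.
  apply: leq_trans (size_polyMleq _ _) _.
  move: (leq_add (x_size i) (y_size (l - i)%N)); rewrite addnS addSn.
  by case: (_ + _)%N.
- move=> x l; rewrite coefC; case: eqP => _; last by rewrite size_poly0.
  by rewrite size_polyC leq_b1.
move=> y i l; rewrite coefD; apply: leq_trans (size_polyD _ _) _.
rewrite geq_max; apply/andP; split.
  rewrite coefC; case: eqP => _; last by rewrite size_poly0.
  by rewrite (leq_trans (size_poly _ _)).
case: (moved y); last by rewrite coef0 size_poly0.
rewrite mul_polyC coefZ coefX; apply: leq_trans (size_polyMleq _ _) _.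
rewrite size_polyC; case: (l == 1)%N; last by rewrite size_poly0; case: (_ != _).
by rewrite size_poly1; case: (_ != _).
Qed.

(** The unperturbed part of the first vector convolves the powers of [X]; its part [eps x], if
    present, raises the power of [eps] by one. *)
Lemma polar_perturb_cons y s g k m :
  (polarp (y :: s) g)`_k`_m =
  \sum_(i < n) \sum_(a < m.+1) (u y i)`_a *: (polarp s g^`M(i))`_k`_(m - a) +
  (if moved y && (0 < k)%N then
     \sum_(i < n) 'X_i * (polarp s g^`M(i))`_k.-1`_m else 0).
Proof.
rewrite /polarp /= /perturb.
under eq_bigr do rewrite mulrDl.
rewrite big_split /= coefD coefD; congr (_ + _).
  rewrite !coef_sum; apply: eq_bigr => i _.
  rewrite coefCM coefM; apply: eq_bigr => a _.
  by rewrite coef_map /= mul_mpolyC.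
case: (moved y) => /=; last by rewrite big1 ?coef0 // => i _; rewrite mul0r.
rewrite !coef_sum; case: k => [|k] /=.
  by rewrite big1 // => i _; rewrite -mulrA coefCM coefXM mulr0 coef0.
by apply: eq_bigr => i _; rewrite -mulrA coefCM coefXM coefCM.
Qed.

(** In the coefficient of [eps ^ k], the vector [x] fills [k] places, where by Euler's identity it
    only produces scalars. The remaining places give an operator of order [size s - k]. *)
Lemma coef_polar_perturb_diffop s k m : (k <= size s)%N ->
  exists2 th, diffop (size s - k) th &
    forall g, g \is (size s).-homog -> (polarp s g)`_k`_m = th g.
Proof.
elim: s k m => [|y s IHs] k m /=.
  rewrite leqn0 => /eqP->.
  exists (if m == 0%N then id else fun=> 0).
    by case: eqP => _; [exact: diffop_id|exact: diffop_zero].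
  move=> g /homog0_const g_const; rewrite /polarp /cst /= !coefC /=.
  by case: eqP => // _; rewrite -g_const.
move=> le_ks.
have [th1 th1_op Hth1] : exists2 th, diffop ((size s).+1 - k) th &
    forall g, g \is (size s).+1.-homog ->
    \sum_(i < n) \sum_(a < m.+1) (u y i)`_a *: (polarp s g^`M(i))`_k`_(m - a) =
    th g.
  have [le_ks'|lt_sk] := leqP k (size s); last first.
    exists (fun=> 0); first exact: diffop_zero.
    move=> g _; rewrite big1 // => i _; rewrite big1 // => a _.
    rewrite [(polarp _ _)`_k]nth_default ?coef0 ?scaler0 //.
    apply: leq_trans (size_polar_perturb _ _) _.
    by apply: leq_ltn_trans (count_size _ _) lt_sk.
  have /choice[th Hth] : forall a : 'I_m.+1, exists th, diffop (size s - k) th /\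
      forall g, g \is (size s).-homog -> (polarp s g)`_k`_(m - a) = th g.
    by move=> a; have [th] := IHs k (m - a)%N le_ks'; exists th.
  exists (fun g => \sum_(i < n) \sum_(a < m.+1) (u y i)`_a *: th a g^`M(i)).
    rewrite subSn //.
    apply: diffop_sum => i; apply: (@diffop_deriv _ _ _ _
      (fun g => \sum_(a < m.+1) (u y i)`_a *: th a g)).
    by apply: diffop_sum => a; apply: diffop_scale; have [] := Hth a.
  move=> g g_homog; apply: eq_bigr => i _; apply: eq_bigr => a _.
  by have [_ ->] := Hth a; last exact: mderiv_homog.
have [th2 th2_op Hth2] : exists2 th, diffop ((size s).+1 - k) th &
    forall g, g \is (size s).+1.-homog ->
    (if moved y && (0 < k)%N then
     \sum_(i < n) 'X_i * (polarp s g^`M(i))`_k.-1`_m else 0) = th g.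
  case: andP => [[_ k_gt0]|_]; last first.
    by exists (fun=> 0); first exact: diffop_zero.
  clear th1 th1_op Hth1; case: k k_gt0 le_ks => // k _ le_ks.
  have [th th_op Hth] := IHs k m le_ks.
  (* The factor is the degree of [th g], from Euler's identity. *)
  exists (fun g => k.+1%:R *: th g); first by rewrite subSS; apply: diffop_scale.
  move=> g g_homog; rewrite scaler_nat -(mpoly_euler (k := k.+1)).
    apply: eq_bigr => i _; rewrite -(diffop_comm th_op).
    by rewrite -Hth //; apply: mderiv_homog.
  have := diffop_homog th_op (_ : size s - k <= (size s).+1)%N g_homog.
  rewrite subSn ?leq_subr // subKn //; apply.
  by rewrite (leq_trans (leq_subr _ _)).
exists (fun g => th1 g + th2 g); first exact: diffop_add.
by move=> g g_homog; rewrite polar_perturb_cons Hth1 ?Hth2.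
Qed.

(** The vector [x] fills every place, and repeated use of Euler's identity produces the
    factorial. *)
Lemma top_coef_polar_perturb s g m : all moved s -> g \is (size s).-homog ->
  (polarp s g)`_(size s)`_m = if m == 0%N then g *+ (size s)`! else 0.
Proof.
elim: s g m => [|y s IHs] g m /=.
  move=> _ /homog0_const g_const; rewrite /polarp /cst /= !coefC /=.
  by case: eqP => // _; rewrite -g_const.
move=> /andP[y_moved s_moved] g_homog; rewrite polar_perturb_cons y_moved /=.
rewrite big1 ?add0r => [|i _]; last first.
  rewrite big1 // => a _; rewrite [(polarp _ _)`__]nth_default ?coef0 ?scaler0 //.
  apply: leq_trans (size_polar_perturb _ _) _.
  by rewrite ltnS count_size.
under eq_bigr => i _ do rewrite IHs // ?mderiv_homog //.
case: eqP => _; last by rewrite big1 // => i _; rewrite mulr0.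
under eq_bigr do rewrite mulrnAr.
by rewrite sumrMnl (mpoly_euler g_homog) -mulrnA factS.
Qed.

End Perturbation.

(** * Generating the form from a relation *)

(** Solving the relation for the top term of [c t], which is [eps ^ d] times [d! f], expresses its
    product with the linear part through coefficients in the subalgebra. Setting [eps = 0] turns the
    linear part into a nonzero element of [K[X]], and its leading coefficient can be divided out. *)
Lemma relation_generates (K : fieldType) (d N n e : nat) (f : {mpoly K[n]})
    (u : 'I_d -> 'I_N -> 'I_n -> {poly K}) (t : {ffun 'I_d -> 'I_N})
    (g : {set {ffun 'I_d -> 'I_N}} -> K) :
    let moved u j i := perturb (u j i) (i == t j) in
    f \is d.-homog -> d`!%:R != 0 :> K ->
    (forall j i k, size (u j i k) <= e.+1)%N ->
    multilin (cst K n) g (fun I => polar (cst K n) (slots (moved u) I) f) = 0 ->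
    multilin polyC (lin_part t g) (fun I => polar polyC (slots u I) f) != 0 ->
  exists gs : seq {mpoly K[n]},
    [/\ size gs = (N ^ d * (d.-1 * (d * e).+1))%N,
        [set` gs] `<=` deriv_space d f & subalgebra_gen [set` gs] f].
Proof.
move=> moved f_homog d_fact u_size rel lin_n0.
pose c I := polar (cst K n) (slots (moved u) I) f.
have c_op I k m : (k <= d)%N ->
    exists2 th, diffop (d - k) th & (c I)`_k`_m = th f.
  move=> le_kd; have := @coef_polar_perturb_diffop K n 'I_d (fun j => u j (I j))
    (fun j => I j == t j) (enum 'I_d) k m.
  rewrite size_enum_ord => /(_ le_kd)[th th_op Hth].
  by exists th => //; apply: Hth.
have c_size I : (size (c I) <= (count (fun j => I j == t j) (enum 'I_d)).+1)%N.
  exact: (@size_polar_perturb K n 'I_d (fun j => u j (I j)) (fun j => I j == t j)).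
have c_size_coef I k : (size ((c I)`_k)%R <= (d * e).+1)%N.
  have := @size_coef_polar_perturb K n 'I_d (fun j => u j (I j))
    (fun j => I j == t j) (enum 'I_d) f e k.
  by rewrite size_enum_ord; apply=> j i; apply: u_size.
have c_top m : (c t)`_d`_m = if m == 0%N then f *+ d`! else 0.
  have := @top_coef_polar_perturb K n 'I_d (fun j => u j (t j))
    (fun j => t j == t j) (enum 'I_d) f m.
  rewrite size_enum_ord; apply=> //.
  by apply/allP => j _; rewrite eqxx.
(* The powers [eps ^ 1], ..., [eps ^ d.-1] are taken; [eps ^ 0] contributes only scalars. *)
pose T := ({ffun 'I_d -> 'I_N} * ('I_d.-1 * 'I_(d * e).+1))%type.
pose gen (x : T) := (c x.1)`_(x.2.1).+1`_x.2.2.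
exists [seq gen x | x <- enum {: T}]; split.
- by rewrite size_map -cardE !card_prod card_ffun !card_ord.
- move=> _ /mapP[[I [k m]] _ ->] /=; rewrite /gen /=.
  have lt_kd : (k.+1 < d)%N by rewrite -ltn_predRL.
  have [th th_op ->] := c_op I k.+1 m (ltnW lt_kd).
  apply: diffop_deriv_space th_op _.
  by rewrite subn_gt0 lt_kd ltn_subrL (leq_trans _ lt_kd).
move=> U [/subalg_closed_set[U1 UD UM UZ] genU].
have U0 : U 0 by rewrite -[0](scale0r 1); apply: UZ.
(* [V] is the ring of polynomials in [eps] and [X] with coefficients in [U]. *)
pose V (b : {poly {poly {mpoly K[n]}}}) := forall k m, U b`_k`_m.
have V0 : V 0 by move=> k m; rewrite !coef0.
have VD b b' : V b -> V b' -> V (b + b').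
  by move=> Vb Vb' k m; rewrite !coefD; apply: UD.
have VM b b' : V b -> V b' -> V (b * b').
  move=> Vb Vb' k m; rewrite coefM coef_sum.
  apply: (big_ind U) => // i _; rewrite coefM.
  by apply: (big_ind U) => // j _; apply: UM.
have VN b : V b -> V (- b).
  by move=> Vb k m; rewrite !coefN -scaleN1r; apply: UZ.
have V_cst x : V (cst K n x).
  move=> k m; rewrite /cst /= coefC; case: eqP => _; last by rewrite coef0.
  rewrite coefC; case: eqP => _ //.
  by rewrite -alg_mpolyC; apply: UZ.
have V1 : V 1 by rewrite -(rmorph1 (cst K n)); apply: V_cst.
have Uc_low I k m : (k < d)%N -> U (c I)`_k`_m.
  case: k => [_|k lt_kd].
    have [th th_op ->] := c_op I 0%N m (leq0n d).
    have := diffop_homog th_op (leq_subr _ _) f_homog.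
    rewrite subn0 subnn => /homog0_const ->.
    by rewrite -alg_mpolyC; apply: UZ.
  have [le_m|lt_m] := leqP (d * e).+1 m.
    by rewrite [_`_m]nth_default // (leq_trans (c_size_coef _ _)).
  have lt_kd' : (k < d.-1)%N by rewrite ltn_predRL.
  apply: genU; apply/mapP.
  by exists (I, (Ordinal lt_kd', Ordinal lt_m)); rewrite ?mem_enum.
(* Some vector is not moved here, so [eps ^ d] does not occur. *)
have Vc I : I != t -> V (c I).
  move=> It k m; have [/Uc_low//|le_dk] := ltnP k d.
  rewrite [_`_k]nth_default ?coef0 //; apply: leq_trans (c_size I) _.
  apply: leq_trans le_dk.
  rewrite -[X in (_ < X)%N](size_enum_ord d) ltn_neqAle count_size andbT.
  rewrite -all_count; apply: contra It => /allP It; apply/eqP/ffunP => j.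
  by apply/eqP/It; rewrite mem_enum.
pose top : {poly {poly {mpoly K[n]}}} := (f *+ d`!)%:P%:P * 'X^d.
have Vrho : V (c t - top).
  move=> k m; rewrite !coefB coefCM coefXn.
  have [lt_kd|lt_dk|->] := ltngtP k d.
  - by rewrite mulr0 coef0 subr0; apply: Uc_low.
  - rewrite mulr0 coef0 subr0 [_`_k]nth_default ?coef0 //.
    apply: leq_trans (c_size t) _; apply: leq_ltn_trans lt_dk.
    by rewrite -[X in (_ <= X)%N](size_enum_ord d) count_size.
  by rewrite mulr1 coefC c_top; case: eqP => _; rewrite subrr.
have V_part (h : {set {ffun 'I_d -> 'I_N}} -> K) :
    (forall E : {set {ffun 'I_d -> 'I_N}}, t \in E -> h E = 0) ->
    V (multilin (cst K n) h c).
  move=> h_t; apply: (big_ind V); [exact: V0|exact: VD|move=> E _].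
  have [/h_t->|tE] := boolP (t \in E).
    rewrite rmorph0 mul0r; exact: V0.
  apply: (VM); first exact: V_cst.
  apply: (big_ind V); [exact: V1|exact: VM|move=> I IE].
  by apply: Vc; apply: contraNneq tE => <-.
pose lin := multilin (cst K n) (lin_part t g) c.
have lin_V : V lin by apply: V_part => E tE; rewrite /lin_part tE.
have top_lin : V (top * lin).
  have -> : top * lin =
      - (multilin (cst K n) (free_part t g) c + (c t - top) * lin).
    move/eqP: rel; rewrite (multilin_split _ _ t) -/c -/lin -/(c t).
    rewrite -[in X in X -> _](subrK top (c t)) mulrDl addrA addrC addr_eq0.
    by move/eqP.
  apply: VN; apply: VD; last exact: VM.
  by apply: V_part => E tE; rewrite /free_part tE.
set q := multilin polyC _ _ in lin_n0.
have lin0 : lin`_0 = map_poly (@mpolyC n K) q.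
  rewrite -horner_coef0 /lin /q.
  pose e0 : {rmorphism {poly {poly {mpoly K[n]}}} -> {poly {mpoly K[n]}}} :=
    horner_eval 0.
  pose phi : K -> {poly {mpoly K[n]}} := polyC \o @mpolyC n K.
  rewrite -[LHS]/(e0 _) (rmorph_multilin (psi' := phi)); last first.
    by move=> x; apply: hornerC.
  rewrite (rmorph_multilin (psi' := phi)); last by move=> x /=; rewrite map_polyC.
  apply: eq_multilin => I.
  rewrite (@polar_map _ _ _ _ _ idfun e0 _ phi); last by move=> x; apply: hornerC.
  rewrite (@polar_map _ _ _ _ _ idfun (map_poly (@mpolyC n K)) _ phi); last first.
    by move=> x /=; rewrite map_polyC.
  rewrite !slots_map; congr (polar _ (slots _ _) _).
  apply/funext => j; apply/funext => i; apply/funext => k.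
  rewrite /e0 /= horner_evalE /moved /perturb hornerD hornerC.
  by case: eqP => _; rewrite ?hornerM ?hornerX ?mulr0 ?horner0 addr0.
have lead_n0 : lead_coef q * d`!%:R != 0 by rewrite mulf_neq0 ?lead_coef_eq0.
(* The coefficient of [eps ^ d] and of the highest power of [X] in [q]. *)
have := top_lin d (size q).-1.
rewrite /top -mulrA coefCM coefXnM ltnn subnn lin0 coefCM coef_map /=.
rewrite -/(lead_coef q) mulrC mul_mpolyC -scaler_nat scalerA.
move=> /(UZ (lead_coef q * d`!%:R)^-1).
by rewrite scalerA mulVf // scale1r.
Qed.

(** * Numerical bounds and conclusion *)

(** For forms of degree [d.+1]. With [N] equal to this number, [N ^ d.+1] is exactly nine times the
    number [deg_bound d r] of parameters, which is also the degree of the relation. *)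
Definition dim_bound (d r : nat) : nat := (18 * (r * 2 ^ d.+1))%N.
Definition deg_bound (d r : nat) : nat :=
  (2 * (r * 2 ^ d.+1 * dim_bound d r ^ d))%N.

Lemma closure_generates (K : fieldType) (d n r e : nat) (f : {mpoly K[n]})
    (dd : 'I_r -> nat) (S : seq {poly K}) :
    (0 < r)%N -> f \is d.+1.-homog -> (d.+1)`!%:R != 0 :> K ->
    (forall k, 0 < dd k < d.+1)%N -> mu_closure d.+1 dd K f ->
    uniq S -> (d.+1 * deg_bound d r < size S)%N ->
    {in S, forall p : {poly K}, size p <= e.+1}%N ->
  exists gs : seq {mpoly K[n]},
    [/\ size gs = (dim_bound d r ^ d.+1 * (d * (d.+1 * e).+1))%N,
        [set` gs] `<=` deriv_space d.+1 f & subalgebra_gen [set` gs] f].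
Proof.
move=> r_gt0 f_homog d_fact dd_bounds f_cl S_uniq S_size S_deg.
set N := dim_bound d r; set D := deg_bound d r in S_size.
have N_gt0 : (0 < N)%N by rewrite !muln_gt0 r_gt0 expn_gt0.
have [|v [w [vw v_supp v_rel]]] := @low_strength_dependence d r N r_gt0 N_gt0.
  have NE : N = (9 * (2 * (r * 2 ^ d.+1)))%N by rewrite mulnA.
  by rewrite (expnS N) [X in (_ <= X * _)%N]NE !mulnA.
have f_rel := closure_relation dd_bounds f_cl v_rel.
pose vK (E : {set {ffun 'I_d.+1 -> 'I_N}}) : K := (v E)%:~R.
(* Quantifying over all domains over [K] keeps the notion meaningful for finite [K]: a failure may
   be witnessed by vectors over a larger domain. *)
pose V (g : {set {ffun 'I_d.+1 -> 'I_N}} -> K) :=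
  forall (B : idomainType) (phi : {rmorphism K -> B}) u,
  multilin phi g (fun I => polar phi (slots u I) f) = 0.
have [|||| g [t [Vg nVg g_supp]]] := @minimal_relation K _ V D vK.
- move=> g Vg g0; have := Vg K idfun (fun _ _ _ => 0).
  rewrite /multilin (bigD1 finset.set0) //= big_set0 mulr1 big1 ?addr0 //.
  by move=> E /g0->; rewrite mul0r.
- move=> B phi u; rewrite -(f_rel B phi u); apply: eq_bigr => E _.
  by rewrite rmorph_int.
(* The identity with [w] survives in [K] whatever its characteristic, so [vK] is not zero. *)
- apply: contrapT => noE; have /(congr1 (fun x : int => x%:~R : K)) := vw.
  rewrite rmorph_sum big1 => [/esym/eqP|E _]; first by rewrite oner_eq0.
  rewrite rmorphM /=; have [vE|vE] := eqVneq (vK E) 0.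
    by rewrite -/(vK E) vE mul0r.
  by case: noE; exists E.
- move=> E vE; rewrite v_supp //.
  by apply: contraNneq vE; rewrite /vK => ->.
move/existsNP: nVg => [B /existsNP[phi /existsNP[u /eqP lin_n0]]].
have [u' u'_in lin'_n0] := specialise g_supp S_uniq S_size lin_n0.
apply: (@relation_generates K d.+1 N n e f u' t g) => //.
  by move=> j i k; apply: S_deg.
(* Identifying the two ring structures once avoids a costly unification. *)
have V_ring (B' : idomainType) (R : comNzRingType) : R = B' ->
    forall (phi' : {rmorphism K -> R}) u,
    multilin phi' g (fun I => polar phi' (slots u I) f) = 0.
  by move=> ->; exact: Vg.
exact: (V_ring {poly {poly {mpoly K[n]}}} {poly {poly {mpoly K[n]}}} erefl).
Qed.

(** The image is the origin, which the coordinates cut out as a closed subset. *)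
Lemma closure0 (K : fieldType) (d n : nat) (f : {mpoly K[n]}) (dd : 'I_0 -> nat) :
  mu_closure d dd K f -> f = 0.
Proof.
move=> [f_homog /(_ [set P | exists i, P = 'X_i])[L g [a [b [_ ->]]]|_ f0]].
  rewrite big_ord0; split=> [|_ [i ->]]; first exact: dhomog0.
  by rewrite /coord_eval mmapX mmap1U mcoeff0.
rewrite -(map_generic_form f_homog); apply/mpolyP => m.
rewrite mcoeff_map_mpoly mcoeff0 /generic_form raddf_sum /coord_eval raddf_sum /=.
rewrite big1 // => i _.
rewrite mcoeffZ rmorphM /= (_ : mmap _ _ 'X_i = 0) ?mul0r //.
by apply: f0; exists i.
Qed.

Lemma fact_neq0 (K : fieldType) (d : nat) :
    ([pchar K] =i pred0 \/ exists2 p : nat, p \in [pchar K] & (d < p)%N) ->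
  d`!%:R != 0 :> K.
Proof.
case=> [/pcharf0P ->|[p p_char lt_dp]]; first by rewrite -lt0n fact_gt0.
rewrite -(dvdn_pcharf p_char) fact_prod Euclid_dvd_prod ?(pcharf_prime p_char) //.
rewrite big_has; apply/hasPn => i; rewrite mem_index_iota => /andP[i_gt0 le_id].
by rewrite gtnNdvd // (leq_ltn_trans _ lt_dp).
Qed.

(** A finite field may have too few constants. Since 0 and 1 differ in every field, bit strings give
    distinct polynomials. *)
Lemma bit_polys (K : fieldType) (e : nat) :
  exists S : seq {poly K}, [/\ uniq S, size S = (2 ^ e)%N &
    {in S, forall p : {poly K}, size p <= e}%N].
Proof.
pose P (h : {ffun 'I_e -> bool}) : {poly K} :=
  \poly_(i < e) (if insub i is Some j then (h j)%:R else 0).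
exists [seq P h | h <- enum {: {ffun 'I_e -> bool}}]; split.
- rewrite map_inj_uniq ?enum_uniq // => h h' eq_h; apply/ffunP => j.
  move/(congr1 (fun p : {poly K} => p`_j)): eq_h.
  rewrite !coef_poly ltn_ord insubT //= => lt_je.
  rewrite (_ : Sub _ _ = j); last exact: val_inj.
  by case: (h j) (h' j) => [] [] // /eqP; rewrite ?oner_eq0 // eq_sym oner_eq0.
- by rewrite size_map -cardE card_ffun card_bool card_ord.
by move=> _ /mapP[h _ ->]; exact: size_poly.
Qed.

Lemma constant_polys (K : fieldType) (m : nat) : infinite_set [set: K] ->
  exists S : seq {poly K}, [/\ uniq S, (m <= size S)%N &
    {in S, forall p : {poly K}, size p <= 1}%N].
Proof.
move=> /(@infinite_set_fset _ _ m)[B _ leB].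
exists [seq c%:P | c <- finmap.enum_fset B]; split.
- by rewrite map_inj_uniq ?finmap.fset_uniq //; exact: polyC_inj.
- by rewrite size_map.
by move=> _ /mapP[c _ ->]; rewrite size_polyC leq_b1.
Qed.

(** The first summand [c] satisfies [d.+1 * deg_bound d r = c * r ^ d.+1], and
    [c <= 2 ^ c <= r.+1 ^ c] for positive [r]. *)
Definition log_exponent (d : nat) : nat :=
  ((d.+1 * (2 * (2 ^ d.+1 * (18 * 2 ^ d.+1) ^ d))) + d.+1)%N.

Lemma deg_bound_pow (d r : nat) :
  (d.+1 * deg_bound d r <= r.+1 ^ log_exponent d)%N.
Proof.
have [->|r_gt0] := posnP r; first by rewrite /deg_bound !mul0n !muln0.
set c := (d.+1 * (2 * (2 ^ d.+1 * (18 * 2 ^ d.+1) ^ d)))%N.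
have -> : (d.+1 * deg_bound d r = c * r ^ d.+1)%N.
  rewrite /deg_bound /dim_bound /c (mulnCA 18 r) (expnMn r) (expnS r).
  rewrite -!mulnA; congr (_ * (_ * _))%N; rewrite mulnCA; congr muln.
  by rewrite mulnA mulnC.
rewrite /log_exponent -/c expnD leq_mul ?leq_exp2r //.
apply: leq_trans (ltnW (ltn_expl c (ltnSn 1))) _.
by case: (posnP c) => [->|c_gt0] //; rewrite leq_exp2r.
Qed.

Lemma trunc_log_le (R : realType) (m r E : nat) : (0 < m)%N -> (0 < r)%N ->
  (m <= r.+1 ^ E)%N -> (trunc_log 2 m)%:R <= E%:R * log2 (r.+1%:R : R).
Proof.
move=> m_gt0 r_gt0 m_le.
have ln2_gt0 : 0 < ln (2 : R) by rewrite ln_gt0 // ltr1n.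
rewrite /log2 mulrA ler_pdivlMr // !mulr_natl -!lnXn ?ltr0n //.
rewrite ler_ln ?posrE ?exprn_gt0 ?ltr0n // -!natrX ler_nat.
by apply: leq_trans m_le; apply: trunc_logP.
Qed.

Lemma log2_ge1 (R : realType) (r : nat) : (0 < r)%N -> 1 <= log2 (r.+1%:R : R).
Proof.
move=> r_gt0; have := @trunc_log_le R 2 r 1 isT r_gt0.
by rewrite expn1 ltnS r_gt0 mul1r; apply.
Qed.

Theorem theorem1p7 (R : realType) (d : nat) (d_ge1 : (1 <= d)%N) :
  exists C : R, 0 < C /\
    forall (K : fieldType),
      ([pchar K] =i pred0 \/ exists2 p : nat, p \in [pchar K] & (d < p)%N) ->
    forall (n : nat), (1 <= n)%N ->
    forall (f : {mpoly K[n]}) (r : nat),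
      f \is d.-homog -> has_border_strength d f r ->
      (infinite_set [set: K] ->
         in_deriv_subalgebra d f (C * r%:R ^+ d)) /\
      (finite_set [set: K] ->
         in_deriv_subalgebra d f (C * r%:R ^+ d * log2 (r.+1%:R))).
Proof.
case: d d_ge1 => // d _.
pose A := ((18 * 2 ^ d.+1) ^ d.+1 * d)%N.
(* For linear forms [A] is zero; the outer successor keeps [C] positive. *)
pose C := (A * (d.+1 * log_exponent d).+1)%N.+1.
have dimE r : (dim_bound d r ^ d.+1 * d = A * r ^ d.+1)%N.
  by rewrite /dim_bound /A mulnCA expnMn -mulnA mulnC.
exists C%:R; split=> [|K K_char n _ f r f_homog [[dd [dd_bounds f_cl]] _]].
  by rewrite ltr0n.
have d_fact := fact_neq0 K_char.
(* For [r = 0] the bound is zero, and [f = 0] lies in the subalgebra without generators. *)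
have [r0|r_gt0] := posnP r.
  rewrite {r}r0 in dd dd_bounds f_cl *.
  have no_gens : [set` [::]] `<=` deriv_space d.+1 f by [].
  have f_gen : subalgebra_gen [set` [::]] f.
    move=> U [/subalg_closed_set[U1 _ _ UZ] _].
    by rewrite (closure0 f_cl) -(scale0r 1); apply: UZ.
  by split=> _; exists [::]; rewrite expr0n /= ?mulr0 ?mul0r; split.
pose M := (d.+1 * deg_bound d r)%N.
split=> [K_inf|_].
  have [S [S_uniq S_size S_deg]] := constant_polys M.+1 K_inf.
  have [gs [gs_size gs_deriv gs_alg]] :=
    closure_generates r_gt0 f_homog d_fact dd_bounds f_cl S_uniq S_size S_deg.
  exists gs; split=> //.
  rewrite gs_size muln0 muln1 dimE -natrX -natrM ler_nat leq_mul2r.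
  by rewrite /C mulnS ltnW ?orbT // ltnS leq_addr.
have M_gt0 : (0 < M)%N by rewrite !muln_gt0 r_gt0 !expn_gt0 !muln_gt0 r_gt0 expn_gt0.
(* This is the size at which the number of bit strings exceeds [M]. *)
have [S [S_uniq S_size S_deg]] := bit_polys K (trunc_log 2 M).+1.
have ltS : (M < size S)%N by rewrite S_size trunc_log_ltn.
have [gs [gs_size gs_deriv gs_alg]] :=
  closure_generates r_gt0 f_homog d_fact dd_bounds f_cl S_uniq ltS S_deg.
exists gs; split=> //; rewrite gs_size mulnA dimE.
set L : R := log2 _.
have L_ge1 : 1 <= L by apply: log2_ge1.
(* The additional 1 is absorbed because [L] is at least 1. *)
have scale_le (a m E : nat) : m%:R <= E%:R * L -> (a * m).+1%:R <= (a * E).+1%:R * L.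
  move=> le_m; rewrite -[(a * m).+1]addn1 -[(a * E).+1]addn1 !natrD !natrM.
  by rewrite mulrDl mul1r lerD // -mulrA ler_wpM2l.
have e_le := scale_le d.+1 _ _ (trunc_log_le R M_gt0 r_gt0 (deg_bound_pow d r)).
rewrite natrM (natrM _ A) natrX.
have Ar_ge0 : 0 <= A%:R * r%:R ^+ d.+1 :> R by rewrite mulr_ge0 ?exprn_ge0.
apply: le_trans (ler_wpM2l Ar_ge0 e_le) _.
rewrite mulrA ler_wpM2r //; first exact: le_trans L_ge1.
rewrite mulrAC ler_wpM2r ?exprn_ge0 // -natrM ler_nat.
exact: leqnSn.
Qed.
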